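(* Let $X$ and $Y$ be finite-dimensional real Banach spaces. Then the pair $(X,Y)$ has the Bishop-Phelps-Bollobás property on every bounded closed convex subset $D$ of $X$.
   Context: All Banach spaces are over $\mathbb{R}$; $\mathcal{L}(X,Y)$ is the Banach space of bounded linear operators from $X$ to $Y$ with the operator norm $\|\cdot\|$. For a bounded closed convex set $D\subset X$ and $T\in\mathcal{L}(X,Y)$, $\|T\|_D=\sup\{\|Tx\|:x\in D\}$. The pair $(X,Y)$ has the Bishop-Phelps-Bollobás property on $D$ if for every $\epsilon>0$ there is $\eta_D(\epsilon)>0$ such that for every $T\in\mathcal{L}(X,Y)$ with $\|T\|_D=1$ and every $x\in D$ with $\|T(x)\|>1-\eta_D(\epsilon)$, there exist $S\in\mathcal{L}(X,Y)$ and $z\in D$ such that $\|S(z)\|=1=\|S\|_D$, $\|x-z\|<\epsilon$ and $\|T-S\|<\epsilon$. *)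

(* Defs.v *)
From mathcomp Require Import all_boot all_order all_algebra.
From mathcomp Require Import all_classical all_reals all_analysis.

Set Implicit Arguments.
Unset Strict Implicit.
Unset Printing Implicit Defensive.

Import Order.TTheory GRing.Theory Num.Theory.
Import numFieldNormedType.Exports.

Local Open Scope classical_set_scope.
Local Open Scope ring_scope.

Definition finite_dimensional (R : realType) (V : lmodType R) : Prop :=
  exists n : nat, inhabited (Vector.axiom n V).

(* [sup] returns 0 on sets that are empty or unbounded above.  Below, [f] is
   always a bounded linear operator (or a difference of two) and [D] a bounded
   set; the value 0 at [D = set0] is harmless. *)
Definition norm_on (R : realType) (X Y : normedModType R)
    (D : set X) (f : X -> Y) : R :=
  sup [set `|f x| | x in D].

Definition operator_norm (R : realType) (X Y : normedModType R)
    (f : X -> Y) : R :=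
  norm_on [set x | `|x| <= 1] f.

(* An element of L(X, Y) is a [T : {linear X -> Y}] with [bounded_fun_norm T]. *)
Definition BPB_property_on (R : realType) (X Y : normedModType R)
    (D : set X) : Prop :=
  forall eps : R, 0 < eps ->
  exists2 eta : R, 0 < eta &
  forall T : {linear X -> Y}, bounded_fun_norm T -> norm_on D T = 1 ->
  forall x : X, D x -> 1 - eta < `|T x| ->
  exists (S : {linear X -> Y}) (z : X),
    [/\ bounded_fun_norm S, D z, `|S z| = 1 & norm_on D S = 1] /\
    `|x - z| < eps /\ operator_norm (T \- S) < eps.
Arguments BPB_property_on {R} X Y D.

(* Main.v *)
From HB Require Import structures.
Require Import Defs.
From mathcomp Require Import all_boot all_order all_algebra.
From mathcomp Require Import all_classical all_reals all_analysis.

Import numFieldNormedType.Exports.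

Local Open Scope classical_set_scope.
Local Open Scope ring_scope.

Import Order.TTheory GRing.Theory Num.Theory.

Set Implicit Arguments.
Unset Strict Implicit.
Unset Printing Implicit Defensive.

(** The proof is a compactness argument on the operators restricted to D.

    A bound on the values of T on D says nothing about T off the linear span
    of D, so the operators T with norm 1 on D need not form a bounded set.
    Their restrictions do.  Pick finitely many d_i in D spanning D, with linear
    functionals c_i such that x = sum_i c_i(x) d_i on D ([spanning_family]).
    Then T x = sum_i c_i(x) T(d_i) for x in D, so T is determined on D by the
    vectors T(d_i), which lie in the unit ball of Y because the d_i were taken
    in D itself.  Hence the pairs (v, x), with x in D and v a family in the
    unit ball of Y for which L_v = sum_i c_i v_i is bounded by 1 on D, form a
    compact set K ([combination_compact]).

    The continuous function (v, x) |-> |L_v x| is at most 1 on K.  By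
    compactness, every point of K where it is close enough to 1 is near a point
    (s, z) of K where it equals 1 ([near_max_near_maximizer]), and then
    L_s attains its norm 1 on D at z.  Apply this to (t, x) with t_i = T(d_i)
    and |T x| close to 1, and put S = T + L_(s - t).  On D we have L_t = T,
    hence S = L_s, so S attains its norm 1 on D at z; and S - T = L_(s - t) is
    small in operator norm on the whole of X, because the c_i are bounded. *)

(** * Finite-dimensional normed spaces *)

Lemma finite_dimensional_coord (R : realType) (V : lmodType R) :
  finite_dimensional V ->
  exists (n : nat) (f : {linear V -> 'rV[R]_n}) (g : {linear 'rV[R]_n -> V}),
    cancel f g /\ cancel g f.
Proof.
move=> [n [[f0 lf [g0 fK gK]]]].
pose f : {linear V -> 'rV[R]_n} :=
  HB.pack f0 (GRing.isLinear.Build _ _ _ _ f0 lf).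
have lg : linear g0 by exact: (can2_linear (f := f) fK gK).
pose g : {linear 'rV[R]_n -> V} :=
  HB.pack g0 (GRing.isLinear.Build _ _ _ _ g0 lg).
by exists n, f, g.
Qed.

Lemma coord_le_norm (R : realType) n (v : 'rV[R]_n) i : `|v 0 i| <= `|v|.
Proof.
rewrite [leRHS]/Num.Def.normr /= mx_normrE; apply/bigmax_geP; right => /=.
by exists (ord0, i).
Qed.

Lemma linear_lipschitz_continuous (R : realType) (V W : normedModType R)
    (f : {linear V -> W}) (M : R) :
  (forall v, `|f v| <= M * `|v|) -> continuous f.
Proof.
move=> fM; apply: bounded_linear_continuous; apply/linear_boundedP.
near=> r => v; apply: le_trans (fM v) _.
apply: ler_wpM2r; first exact: normr_ge0.
by near: r; exact: nbhs_pinfty_ge (num_real M).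
Unshelve. all: by end_near. Qed.

Lemma rV_linear_continuous (R : realType) n (W : normedModType R)
  (f : {linear 'rV[R]_n -> W}) : continuous f.
Proof.
apply: (@linear_lipschitz_continuous _ _ _ _ (\sum_i `|f (delta_mx 0 i)|)) => v.
rewrite [v in leLHS]row_sum_delta linear_sum mulr_suml.
apply: le_trans (ler_norm_sum _ _ _) _; apply: ler_sum => i _.
by rewrite linearZ normrZ mulrC ler_wpM2l ?coord_le_norm.
Qed.

(** The norm of [g v] is continuous and does not vanish on the unit sphere,
    which is compact, so it has a positive minimum there; homogeneity does the
    rest.  This is the equivalence of norms in finite dimension. *)
Lemma rV_injective_bounded_below (R : realType) n (W : normedModType R)
    (g : {linear 'rV[R]_n -> W}) : injective g ->
  exists2 m : R, 0 < m & forall v, m * `|v| <= `|g v|.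
Proof.
move=> ginj; pose S := [set v : 'rV[R]_n | `|v| = 1].
have cg : continuous (fun v => `|g v|).
  move=> v; apply: (@continuous_comp _ _ _ g Num.norm).
    exact: rV_linear_continuous.
  exact: norm_continuous.
have scaleS v : v != 0 -> S (`|v|^-1 *: v).
  by move=> v0; rewrite /S/= normrZ normfV normr_id mulVf ?normr_eq0.
have [S0|/set0P/negP] := pselect (S !=set0); last first.
  rewrite negbK => /eqP S0.
  (* The sphere is empty only in dimension 0. *)
  exists 1 => // v; have [->|/scaleS] := eqVneq v 0; last by rewrite S0.
  by rewrite !linear0 !normr0 mulr0.
have cS : compact S.
  apply: bounded_closed_compact.
    by exists 1; split; rewrite ?num_real// => x x1 v /= ->; exact: ltW.
  have -> : S = Num.norm @^-1` [set 1 : R] by [].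
  apply: preimage_closed; last by rewrite -set_itv1; exact: interval_closed.
  by move=> v _; exact: norm_continuous.
have [c /set_mem cin cmin] := compact_EVT_min S0 cS (continuous_subspaceT cg).
exists `|g c|.
  rewrite normr_gt0; apply/eqP => gc0.
  have c0 : c = 0 by apply: ginj; rewrite gc0 linear0.
  by move: cin; rewrite /S/= c0 normr0 => /esym/eqP; rewrite oner_eq0.
move=> v; have [->|v0] := eqVneq v 0; first by rewrite !linear0 !normr0 mulr0.
have /mem_set/cmin := scaleS _ v0.
by rewrite linearZ normrZ normfV normr_id ler_pdivlMl ?normr_gt0// mulrC.
Qed.

Lemma finite_dimensional_coord_continuous (R : realType) (V : normedModType R) :
  finite_dimensional V ->
  exists (n : nat) (f : {linear V -> 'rV[R]_n}) (g : {linear 'rV[R]_n -> V}),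
    [/\ cancel f g, cancel g f, continuous f & continuous g].
Proof.
move=> /finite_dimensional_coord[n [f [g [fK gK]]]]; exists n, f, g.
split=> //; last exact: rV_linear_continuous.
have [m m0 gm] := rV_injective_bounded_below (can_inj gK).
apply: (@linear_lipschitz_continuous _ _ _ _ m^-1) => v.
by rewrite ler_pdivlMl// -[v in leRHS]fK.
Qed.

Lemma finite_dimensional_compact (R : realType) (V : normedModType R)
    (A : set V) :
  finite_dimensional V -> bounded_set A -> closed A -> compact A.
Proof.
move=> /finite_dimensional_coord_continuous[n [f [g [fK gK cf cg]]]] bA cA.
have -> : A = g @` (g @^-1` A).
  apply/seteqP; split=> [v Av|_ [w Aw <-]//].
  by exists (f v); rewrite /= fK.
apply: continuous_compact; first exact: continuous_subspaceT.
apply: bounded_closed_compact; last by move/continuous_closedP : cg; exact.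
have [m m0 gm] := rV_injective_bounded_below (can_inj gK).
have [M M0 AM] := ex_strict_bound_gt0 bA.
exists (m^-1 * M); split; rewrite ?num_real// => x Mx w Aw.
apply: le_trans (ltW Mx); rewrite ler_pdivlMl//.
by apply: le_trans (gm w) _; exact/ltW/AM.
Qed.

Lemma finite_dimensional_linear_continuous (R : realType)
    (V W : normedModType R) (h : {linear V -> W}) :
  finite_dimensional V -> continuous h.
Proof.
move=> /finite_dimensional_coord_continuous[n [f [g [fK gK cf cg]]]].
have -> : h = (h \o g) \o f :> (V -> W) by apply/funext => v /=; rewrite fK.
move=> v; apply: continuous_comp; first exact: cf.
exact: (@rV_linear_continuous _ _ _ (h \o g)).
Qed.

(** Take a matrix of maximal rank among those whose rows are coordinate vectors
    of points of D: adding one more point of D as a row cannot raise the rank,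
    so every point of D is in the row space.  The coefficient functionals come
    from the partial inverse of that matrix.  That the spanning points belong
    to D, and not just to its span, is what bounds T(d_i) by the norm of T
    on D. *)
Lemma spanning_family (R : realType) (V : normedModType R) (D : set V) :
  finite_dimensional V ->
  exists (k : nat) (d : 'I_k -> V) (c : 'I_k -> {linear V -> R^o}),
    (forall i, D (d i)) /\ (forall x, D x -> x = \sum_i c i x *: d i).
Proof.
move=> /finite_dimensional_coord[n [f [g [fK gK]]]].
pose P r := `[< exists (k : nat) (B : 'M[R]_(k, n)),
  (forall i, D (g (row i B))) /\ \rank B = r >].
have exP : exists r, P r.
  exists 0%N; apply/asboolP; exists 0%N, 0; split; last by rewrite mxrank0.
  by case.
have ubP r : P r -> (r <= n)%N.
  by move=> /asboolP[k [B [_ <-]]]; exact: rank_leq_col.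
case: (ex_maxnP exP ubP) => _ /asboolP[k [B [BD <-]]] Bmax.
have DB x : D x -> (f x <= B)%MS.
  move=> Dx; pose B' := col_mx B (f x).
  have BB' : (B <= B')%MS by rewrite -addsmxE addsmxSl.
  have fB' : (f x <= B')%MS by rewrite -addsmxE addsmxSr.
  apply: submx_trans fB' _.
  rewrite -(geq_leqif (mxrank_leqif_sup BB')); apply: Bmax; apply/asboolP.
  exists (k + 1)%N, B'; split=> // i; case: (split_ordP i) => j ->.
    by rewrite rowKu.
  by rewrite rowKd ord1 row_id fK.
pose c0 i (x : V) : R^o := (f x *m pinvmx B) 0 i.
have lc i : linear (c0 i).
  by move=> a x y; rewrite /c0 linearP mulmxDl -scalemxAl !mxE.
pose c i : {linear V -> R^o} :=
  HB.pack (c0 i) (GRing.isLinear.Build _ _ _ _ (c0 i) (lc i)).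
exists k, (fun i => g (row i B)), c; split=> // x /DB xB.
rewrite -[LHS]fK -(mulmxKpV xB) mulmx_sum_row linear_sum.
by apply: eq_bigr => i _; rewrite linearZ.
Qed.

(** * Approximate maximizers on a compact set *)

(** Off the neighbourhood of radius [e] of the set of points where [g] is [a],
    the compact set K leaves a compact set on which [g] has a maximum smaller
    than [a]; the gap is [eta]. *)
Lemma near_max_near_maximizer (R : realType) (T : pseudoMetricType R)
    (K : set T) (g : T -> R) (a e : R) :
  compact K -> {within K, continuous g} -> (forall p, K p -> g p <= a) ->
  0 < e ->
  exists2 eta : R, 0 < eta & forall p, K p -> a - eta < g p ->
    exists q, [/\ K q, g q = a & ball q e p].
Proof.
move=> cK cg ga e0.
pose Z := [set q | K q /\ g q = a].
pose U := \bigcup_(q in Z) (ball q e)°.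
have oU : open U by apply: bigcup_open => q _; exact: open_interior.
pose L := K `&` ~` U.
have cL : compact L by apply: compact_closedI => //; exact: open_closedC.
have inU p : K p -> ~ L p -> exists q, [/\ K q, g q = a & ball q e p].
  move=> Kp nLp; have [|nUp] := pselect (U p); last by case: nLp.
  by move=> [q [Kq gq] /interior_subset]; exists q.
have [L0|L0] := pselect (L !=set0); last first.
  by exists 1 => // p Kp _; apply: inU => // Lp; apply: L0; exists p.
have cgL : {within L, continuous g}.
  by apply: continuous_subspaceW cg; exact: subIsetl.
have [c /set_mem[Kc nUc] cmax] := compact_EVT_max L0 cL cgL.
exists (a - g c).
  rewrite subr_gt0 lt_neqAle ga// andbT; apply/eqP => gc; apply: nUc.
  by exists c => //; exact: nbhsx_ballx.
move=> p Kp; rewrite opprB addrC subrK => gcp; apply: inU => // /mem_set/cmax.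
by rewrite leNgt gcp.
Qed.

(** * The norm on a set *)

(** A supremum equal to 0 may be the default value for an unbounded set; any
    other value is a true upper bound. *)
Lemma ubound_norm_on (R : realType) (X Y : normedModType R) (D : set X)
    (f : X -> Y) : norm_on D f != 0 ->
  forall x, D x -> `|f x| <= norm_on D f.
Proof.
move=> nf0 x Dx; apply: sup_upper_bound; last by exists x.
by apply: contrapT => /sup_out nf; move: nf0; rewrite /norm_on nf eqxx.
Qed.

Lemma norm_on_attained (R : realType) (X Y : normedModType R) (D : set X)
    (f : X -> Y) (z : X) :
  D z -> (forall x, D x -> `|f x| <= `|f z|) -> norm_on D f = `|f z|.
Proof.
move=> Dz fz.
have ub : ubound [set `|f x| | x in D] `|f z| by move=> _ [x Dx <-]; exact: fz.
apply/eqP; rewrite eq_le; apply/andP; split.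
  by apply: (ge_sup _ ub); exists `|f z|, z.
by apply: sup_upper_bound; [split; [exists `|f z|, z|exists `|f z|]|exists z].
Qed.

Lemma operator_norm_le (R : realType) (X Y : normedModType R) (f : X -> Y)
    (M : R) :
  0 <= M -> (forall x, `|f x| <= M * `|x|) -> operator_norm f <= M.
Proof.
move=> M0 fM; rewrite /operator_norm /norm_on; apply: ge_sup.
  by exists `|f 0|, 0; rewrite //= normr0.
move=> _ [x /= x1 <-]; apply: le_trans (fM x) _.
by rewrite -[leRHS]mulr1 ler_wpM2l.
Qed.

(** * Operators determined by finitely many values *)

Section combination.
Context {R : realType} {X Y : normedModType R} {k : nat}
        (c : 'I_k -> {linear X -> R^o}).

Definition combination (v : 'rV[Y]_k) (x : X) : Y := \sum_i c i x *: v 0 i.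

Lemma combination_linear v : linear (combination v).
Proof.
move=> a x y; rewrite /combination scaler_sumr -big_split.
apply: eq_bigr => i _.
by rewrite linearP scalerDl scalerA.
Qed.

HB.instance Definition _ v := GRing.isLinear.Build R X Y _ (combination v)
  (combination_linear v).

Lemma combination_continuous : (forall i, continuous (c i)) ->
  continuous (fun p : 'rV[Y]_k * X => combination p.1 p.2).
Proof.
move=> cc p; apply: cvg_big => [q|i _]; first exact: add_continuous.
apply: cvgZ.
  by apply: (@continuous_comp _ _ _ snd (c i)); [exact: cvg_snd|exact: cc].
apply: (@continuous_comp _ _ _ fst (fun v : 'rV[Y]_k => v 0 i)).
  exact: cvg_fst.
move=> A /nbhs_ballP[e e0 eA]; apply/nbhs_ballP; exists e => //= v [_ pv].
exact/eA/pv.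
Qed.

Lemma norm_combination_le (C : 'I_k -> R) (e : R) (v : 'rV[Y]_k) (x : X) :
  0 <= e -> (forall i, `|c i x| <= C i * `|x|) -> (forall i, `|v 0 i| <= e) ->
  `|combination v x| <= (\sum_i C i) * e * `|x|.
Proof.
move=> e0 cC ve; apply: le_trans (ler_norm_sum _ _ _) _.
rewrite mulrAC !mulr_suml; apply: ler_sum => i _.
by rewrite normrZ ler_pM.
Qed.

End combination.

(** The first condition defines a product of unit balls of Y, compact because Y
    is finite-dimensional; for each [u] the last one is closed by joint
    continuity. *)
Lemma combination_compact (R : realType) (X Y : normedModType R) (k : nat)
    (c : 'I_k -> {linear X -> R^o}) (D : set X) :
  finite_dimensional Y -> (forall i, continuous (c i)) -> compact D ->
  compact [set p : 'rV[Y]_k * X | [/\ forall i, `|p.1 0 i| <= 1, D p.2 &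
    forall u, D u -> `|combination c p.1 u| <= 1]].
Proof.
move=> fY cc cD.
pose B := [set v : 'rV[Y]_k | forall i, `|v 0 i| <= 1].
have cB : compact B.
  apply: (@rV_compact Y k (fun=> [set y | `|y| <= 1])) => _.
  apply: finite_dimensional_compact => //.
    exists 1; split; rewrite ?num_real// => r r1 y /= /le_trans; apply.
    exact: ltW.
  apply: (@preimage_closed _ _ (Num.norm : Y -> R) [set r | r <= 1]).
    by move=> y _; exact: norm_continuous.
  exact: closed_le.
pose E u := [set p : 'rV[Y]_k * X | `|combination c p.1 u| <= 1].
have cE u : closed (E u).
  apply: (@preimage_closed _ _ (fun p : 'rV[Y]_k * X => `|combination c p.1 u|)
    [set r | r <= 1]); last exact: closed_le.
  move=> p _; apply: cvg_norm.
  apply: (@continuous_comp _ _ _ (fun q : 'rV[Y]_k * X => (q.1, u))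
    (fun q : 'rV[Y]_k * X => combination c q.1 q.2)).
    apply: (@cvg_pair _ _ _ _ (nbhs p.1) (nbhs u)); first exact: cvg_fst.
    exact: cvg_cst.
  exact: combination_continuous.
have cI : closed (\bigcap_(u in D) E u) by apply: closed_bigI => u _; exact: cE.
have := compact_closedI (compact_setX cB cD) cI; congr compact.
apply/seteqP; split=> p.
  by move=> [[Bp Dp] Ep]; split=> // u; exact: Ep.
by move=> [Bp Dp Ep]; split=> // u; exact: Ep.
Qed.

(** * The Bishop-Phelps-Bollobas property *)

Theorem theorem3p1 (R : realType) (X Y : completeNormedModType R)
  (fX : finite_dimensional X) (fY : finite_dimensional Y)
  (D : set X) (bD : bounded_set D) (cD : closed D) (vD : convex_set D) :
  BPB_property_on X Y D.
Proof.
move=> eps eps0.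
have [k [d [c [dD Dd]]]] := spanning_family D fX.
have cc i : continuous (c i) by exact: finite_dimensional_linear_continuous.
have /choice[C cC] : forall i, exists M : R,
    0 <= M /\ forall x, `|c i x| <= M * `|x|.
  move=> i; have /linear_bounded_continuous/linear_boundedP := cc i.
  by move=> /pinfty_ex_gt0[M M0 cM]; exists M; split; first exact: ltW.
pose M := \sum_i C i.
have M0 : 0 <= M by apply: sumr_ge0 => i _; exact: (cC i).1.
have M1 : 0 < M + 1 by rewrite ltr_wpDl.
(* [M] times the largest |v_i| bounds the operator norm of L_v, and
   [M * e < eps]; adding 1 to [M] also gives [e <= eps], for the distance from
   [x] to [z]. *)
pose e := eps / (M + 1).
have e0 : 0 < e by rewrite divr_gt0.
have ee : e <= eps by rewrite ler_pdivrMr// ler_peMr ?lerDr// ltW.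
have cK := combination_compact fY cc (finite_dimensional_compact fX bD cD).
pose g (p : 'rV[Y]_k * X) := `|combination c p.1 p.2|.
have cg : continuous g.
  by move=> p; apply: cvg_norm; exact: combination_continuous.
have [|eta eta0 etaP] := near_max_near_maximizer (a := 1) cK
  (continuous_subspaceT cg) _ e0.
  by move=> p [_ Dp]; exact.
exists eta => // T _ T1 x Dx Tx.
have TD u : D u -> `|T u| <= 1.
  by rewrite -T1; apply: ubound_norm_on; rewrite T1 oner_eq0.
pose t := \row_i T (d i).
have tE u : D u -> combination c t u = T u.
  move=> Du; rewrite [in RHS](Dd u Du) linear_sum; apply: eq_bigr => i _.
  by rewrite mxE linearZ.
have [||[s z] [[/= s1 Dz sD] sz [[_ st] zx]]] := etaP (t, x).
- by split=> //= [i|u Du]; [rewrite mxE TD|rewrite tE// TD].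
- by rewrite /g /= tE.
pose S : {linear X -> Y} := T \+ combination c (s - t).
have combB u : combination c (s - t) u = combination c s u - combination c t u.
  rewrite /combination -sumrB; apply: eq_bigr => i _.
  by rewrite !mxE scalerBr.
have SE u : D u -> S u = combination c s u.
  by move=> Du; rewrite /S /= combB tE// addrC subrK.
have Sz : `|S z| = 1 by rewrite SE.
exists S, z; split; [split=> //|split].
- apply/bounded_funP/linear_bounded_continuous.
  exact: finite_dimensional_linear_continuous.
- by rewrite (norm_on_attained Dz) Sz// => u Du; rewrite SE// sD.
- rewrite distrC; apply: lt_le_trans ee.
  by move: zx; rewrite -ball_normE.
apply: (@le_lt_trans _ _ (M * e)); last first.
  by rewrite mulrA ltr_pdivrMr// mulrC ltr_pM2l// ltrDl.
apply: operator_norm_le => [|u]; first by rewrite mulr_ge0// ltW.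
rewrite /= opprD addNKr normrN.
apply: norm_combination_le (ltW e0) _ _ => i; first exact: (cC i).2.
by have := st 0 i; rewrite -ball_normE /= !mxE => /ltW.
Qed.
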